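(* Let $\alpha\neq0$ be a real number. The Kendall number of the family $\mathcal{H}^\alpha$ of all $\alpha$-admissible homogeneous curves in $\mathcal{L}$ is $2$.
   Context: $\mathcal{L}$ is the space of all oriented straight lines of $\mathbb{R}^3$, i.e. classes $[s\mapsto u+sv]$ with $u,v\in\mathbb{R}^3$, $\|v\|=1$, modulo translations of the parameter $s$. It is a 4-dimensional smooth manifold, diffeomorphic to $TS^2=\{(v,u)\in S^2\times\mathbb{R}^3\mid u\perp v\}$ via $(v,u)\mapsto[s\mapsto u+sv]$. Rigid transformations of $\mathbb{R}^3$ (orientation preserving isometries) act on $\mathcal{L}$ by $g\cdot[\sigma]=[g\circ\sigma]$. Given $\ell\in\mathcal{L}$ with direction $v$ (unit), a point $p\in\ell$ and a unit vector $A\perp v$, put $B=A\times v$. The $\alpha$-helicoidal curve with initial ray $\ell$ and axis $t\mapsto p+tA$ is $\Gamma^\alpha_{\ell,p,A}:\mathbb{R}\to\mathcal{L}$, $\Gamma^\alpha_{\ell,p,A}(t)=[s\mapsto p+tA+s(\cos(\alpha t)v+\sin(\alpha t)B)]$. A tangent vector of $\mathcal{L}$ is $\alpha$-admissible if it equals the initial velocity $(\Gamma^\alpha_{\ell,p,A})'(0)$ of some $\alpha$-helicoidal curve; a smooth curve in $\mathcal{L}$ is $\alpha$-admissible if all its velocities are $\alpha$-admissible. A homogeneous curve in $\mathcal{L}$ is an orbit $t\mapsto g_t\cdot\ell$ of some $\ell\in\mathcal{L}$ under a one-parameter group $t\mapsto g_t$ of rigid transformations of $\mathbb{R}^3$.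 $\mathcal{H}^\alpha$ is the family of all homogeneous curves in $\mathcal{L}$ that are $\alpha$-admissible. Given a family $\mathcal{F}$ of curves in a smooth manifold $N$, the Kendall number of $\mathcal{F}$ is the minimum number of pieces in $\mathcal{F}$ of continuous curves in $N$ taking an initial point to a final point, both arbitrary and different; that is, the least $n$ such that any two different points of $N$ can be joined by a continuous curve that is a concatenation of at most $n$ pieces, each piece being the restriction of a curve in $\mathcal{F}$ to a compact interval. *)

(* Defs.v *)
From Stdlib Require Import Reals Lra Lia ProofIrrelevance.
From Coquelicot Require Import Coquelicot.
Open Scope R_scope.

Definition vec : NormedModule R_AbsRing :=
  prod_NormedModule R_AbsRing
    (prod_NormedModule R_AbsRing R_NormedModule R_NormedModule) R_NormedModule.

Definition mkvec (x y z : R) : vec := (x, y, z).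
Definition cx (u : vec) : R := fst (fst u).
Definition cy (u : vec) : R := snd (fst u).
Definition cz (u : vec) : R := snd u.

Definition vadd (u v : vec) : vec := plus u v.
Definition vsub (u v : vec) : vec := minus u v.
Definition vscal (s : R) (u : vec) : vec := scal s u.

Definition dot (u v : vec) : R := cx u * cx v + cy u * cy v + cz u * cz v.

Definition cross (u v : vec) : vec :=
  mkvec (cy u * cz v - cz u * cy v)
        (cz u * cx v - cx u * cz v)
        (cx u * cy v - cy u * cx v).

Definition enorm (u : vec) : R := sqrt (dot u u).

Definition det3 (u v w : vec) : R := dot (cross u v) w.

Definition vzero : vec := mkvec 0 0 0.
Definition e1 : vec := mkvec 1 0 0.
Definition e2 : vec := mkvec 0 1 0.
Definition e3 : vec := mkvec 0 0 1.

Fixpoint Cn {V : NormedModule R_AbsRing} (n : nat) (f : R -> V) : Prop :=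
  match n with
  | O => forall t, continuous f t
  | S m => exists f' : R -> V, (forall t, is_derive f t (f' t)) /\ Cn m f'
  end.

Definition smooth {V : NormedModule R_AbsRing} (f : R -> V) : Prop :=
  forall n, Cn n f.

(** Oriented lines.  The class of [s |-> u + s v] modulo translations of [s] is
    encoded by its unit direction [v] and its unique point [u] orthogonal to
    [v], that is, by the corresponding point of [TS^2], a submanifold of
    [R^3 * R^3].  [represents] relates a class to its parametrizations. *)

Record oline : Type := mk_oline {
  dir : vec;
  foot : vec;
  dir_unit : enorm dir = 1;
  foot_orth : dot foot dir = 0
}.

Definition point (l : oline) (s : R) : vec := vadd (foot l) (vscal s (dir l)).

Definition on_line (p : vec) (l : oline) : Prop := exists s, p = point l s.

Definition represents (sigma : R -> vec) (l : oline) : Prop :=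
  exists s0, forall s, sigma s = point l (s + s0).

(** The manifold structure of [oline] is the one of [TS^2] as an embedded
    submanifold of [R^3 * R^3]: topology, smoothness and velocities are read
    through [emb]. *)

Definition ambient : NormedModule R_AbsRing := prod_NormedModule R_AbsRing vec vec.

Definition emb (l : oline) : ambient := (dir l, foot l).

Definition oline_ball (x : oline) (e : R) (y : oline) : Prop :=
  ball (emb x) e (emb y).

Lemma oline_ball_center (x : oline) (e : posreal) : oline_ball x e x.
Proof. apply ball_center. Qed.

Lemma oline_ball_sym (x y : oline) (e : R) : oline_ball x e y -> oline_ball y e x.
Proof. apply ball_sym. Qed.

Lemma oline_ball_triangle (x y z : oline) (e f : R) :
  oline_ball x e y -> oline_ball y f z -> oline_ball x (e + f) z.
Proof. apply ball_triangle. Qed.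

Lemma enorm_e3 : enorm e3 = 1.
Proof.
unfold enorm; replace (dot e3 e3) with 1; [apply sqrt_1 |].
unfold dot, e3, mkvec, cx, cy, cz; simpl; ring.
Qed.

Lemma dot_vzero_e3 : dot vzero e3 = 0.
Proof. unfold dot, vzero, e3, mkvec, cx, cy, cz; simpl; ring. Qed.

(** The structure of uniform spaces comes with an (irrelevant) base point. *)
Definition oline_base : oline := mk_oline e3 vzero enorm_e3 dot_vzero_e3.

Definition oline_UniformSpace_mixin : UniformSpace.mixin_of oline :=
  UniformSpace.Mixin oline oline_base oline_ball
    oline_ball_center oline_ball_sym oline_ball_triangle.

Canonical oline_UniformSpace : UniformSpace :=
  UniformSpace.Pack oline oline_UniformSpace_mixin oline.

Definition smooth_curve (gamma : R -> oline) : Prop :=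
  smooth (fun t => emb (gamma t)).

Definition has_velocity (gamma : R -> oline) (t : R) (X : ambient) : Prop :=
  is_derive (fun r => emb (gamma r)) t X.

Lemma oline_ext (l m : oline) : dir l = dir m -> foot l = foot m -> l = m.
Proof.
destruct l as [v u hv hu], m as [v' u' hv' hu']; simpl; intros -> ->.
f_equal; apply proof_irrelevance.
Qed.

Lemma vec_ext (u v : vec) : cx u = cx v -> cy u = cy v -> cz u = cz v -> u = v.
Proof.
destruct u as [[a b] c], v as [[a' b'] c']; unfold cx, cy, cz; simpl.
intros -> -> ->; reflexivity.
Qed.

Lemma enorm_1 (u : vec) : enorm u = 1 <-> dot u u = 1.
Proof.
unfold enorm; split; intros h.
- assert (h0 : 0 <= dot u u) by (unfold dot; nra).
  rewrite <- (sqrt_sqrt _ h0), h; ring.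
- rewrite h; apply sqrt_1.
Qed.

Ltac vec_simpl :=
  unfold point, vadd, vsub, vscal, minus, dot, cross, mkvec, cx, cy, cz in *; simpl in *;
  unfold plus, opp, scal, mult in *; simpl in *; unfold mult in *; simpl in *.

Lemma represents_exists (u v : vec) :
  enorm v = 1 -> exists l, represents (fun s => vadd u (vscal s v)) l.
Proof.
intros hv; pose proof (proj1 (enorm_1 v) hv) as hv1.
assert (ho : dot (vsub u (vscal (dot u v) v)) v = 0).
{ transitivity (dot u v * (1 - dot v v)); [vec_simpl; ring | rewrite hv1; ring]. }
exists (mk_oline v (vsub u (vscal (dot u v) v)) hv ho), (dot u v).
intros s; apply vec_ext; vec_simpl; ring.
Qed.

Lemma represents_unique (sigma : R -> vec) (l m : oline) :
  represents sigma l -> represents sigma m -> l = m.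
Proof.
intros [a ha] [b hb].
assert (h : forall s, point l (s + a) = point m (s + b)).
{ intros s; rewrite <- ha; apply hb. }
assert (hd : dir l = dir m).
{ pose proof (h 0) as h0; pose proof (h 1) as h1.
  apply vec_ext.
  - apply (f_equal cx) in h0; apply (f_equal cx) in h1; vec_simpl; lra.
  - apply (f_equal cy) in h0; apply (f_equal cy) in h1; vec_simpl; lra.
  - apply (f_equal cz) in h0; apply (f_equal cz) in h1; vec_simpl; lra. }
apply oline_ext; [exact hd |].
pose proof (proj1 (enorm_1 _) (dir_unit l)) as hu.
pose proof (foot_orth l) as hl; pose proof (foot_orth m) as hm.
pose proof (h 0) as h0; rewrite <- hd in hm; unfold point in h0; rewrite <- hd in h0.
assert (hab : a = b).
{ assert (k : dot (vadd (foot l) (vscal (0 + a) (dir l))) (dir l)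
            = dot (vadd (foot m) (vscal (0 + b) (dir l))) (dir l)) by now rewrite h0.
  assert (e : forall w s, dot (vadd w (vscal (0 + s) (dir l))) (dir l)
            = dot w (dir l) + s * dot (dir l) (dir l)) by (intros; vec_simpl; ring).
  rewrite !e, hl, hm, hu in k; lra. }
subst b; apply vec_ext.
- apply (f_equal cx) in h0; vec_simpl; lra.
- apply (f_equal cy) in h0; vec_simpl; lra.
- apply (f_equal cz) in h0; vec_simpl; lra.
Qed.

(** Initial ray [l], axis [t |-> p + t A], with the conditions that make
    [(l, p, A)] a legitimate datum; [B = cross A (dir l)]. *)
Definition helicoidal (alpha : R) (l : oline) (p A : vec) (Gamma : R -> oline) : Prop :=
  on_line p l /\ enorm A = 1 /\ dot A (dir l) = 0 /\
  forall t, represents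
    (fun s => vadd (vadd p (vscal t A))
                (vscal s (vadd (vscal (cos (alpha * t)) (dir l))
                               (vscal (sin (alpha * t)) (cross A (dir l))))))
    (Gamma t).

(** [X] is meant as a tangent vector at [l]; [Gamma 0 = l] for every
    helicoidal curve with initial ray [l]. *)
Definition admissible_vector (alpha : R) (l : oline) (X : ambient) : Prop :=
  exists (p A : vec) (Gamma : R -> oline),
    helicoidal alpha l p A Gamma /\ has_velocity Gamma 0 X.

Definition admissible_curve (alpha : R) (gamma : R -> oline) : Prop :=
  smooth_curve gamma /\
  forall t, exists X, has_velocity gamma t X /\ admissible_vector alpha (gamma t) X.

Definition isometry (g : vec -> vec) : Prop :=
  forall x y, enorm (vsub (g x) (g y)) = enorm (vsub x y).

(** An isometry is affine, so the columns of its linear part are the images of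
    the standard basis minus the image of the origin. *)
Definition orientation_preserving (g : vec -> vec) : Prop :=
  0 < det3 (vsub (g e1) (g vzero)) (vsub (g e2) (g vzero)) (vsub (g e3) (g vzero)).

Definition rigid (g : vec -> vec) : Prop := isometry g /\ orientation_preserving g.

(** Since a rigid transformation is determined, smoothly, by the images of
    finitely many points, smoothness of [t |-> g t] as a curve in the Lie group
    of rigid transformations is smoothness of [t |-> g t x] for all [x]. *)
Definition one_parameter_group (g : R -> vec -> vec) : Prop :=
  (forall t, rigid (g t)) /\
  (forall x, g 0 x = x) /\
  (forall s t x, g (s + t) x = g s (g t x)) /\
  (forall x, smooth (fun t => g t x)).

Definition homogeneous_curve (gamma : R -> oline) : Prop :=
  exists (g : R -> vec -> vec) (l : oline),
    one_parameter_group g /\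
    forall t, represents (fun s => g t (point l s)) (gamma t).

Definition Hfam (alpha : R) (gamma : R -> oline) : Prop :=
  homogeneous_curve gamma /\ admissible_curve alpha gamma.

(** The breakpoints of the concatenation are
    [tau 0 < ... < tau k]; the shift [h] accounts for the parameter interval
    [[tau i + h, tau (S i) + h]] on which the curve [f] is used. *)

Definition joined_by {N : UniformSpace} (F : (R -> N) -> Prop) (n : nat) (x y : N) : Prop :=
  exists (k : nat) (c : R -> N) (tau : nat -> R),
    (k <= n)%nat /\
    c (tau O) = x /\ c (tau k) = y /\
    continuous_on (fun t => tau O <= t <= tau k) c /\
    forall i, (i < k)%nat ->
      tau i < tau (S i) /\
      exists (f : R -> N) (h : R),
        F f /\ forall t, tau i <= t <= tau (S i) -> c t = f (t + h).

Definition all_joined_by {N : UniformSpace} (F : (R -> N) -> Prop) (n : nat) : Prop :=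
  forall x y : N, x <> y -> joined_by F n x y.

Definition is_kendall_number {N : UniformSpace} (F : (R -> N) -> Prop) (n : nat) : Prop :=
  all_joined_by F n /\ forall m, all_joined_by F m -> (n <= m)%nat.

(* Main.v *)
Require Import Defs.
From Stdlib Require Import Reals Lra Lia.
From Coquelicot Require Import Coquelicot.
Open Scope R_scope.

(** A tangent vector [(v', u')] at the line [(v, u)] is [alpha]-admissible iff
    [|v'| = |alpha|] and [u' . (v x v') = alpha].

    One piece does not suffice: no line is joined to itself with the opposite
    orientation. Along an orbit [v' = omega x v] with [omega] fixed, so [omega . v]
    is constant; it vanishes if [v] is reversed. Then [v x v' = omega], hence
    [foot . omega] grows at the constant rate [alpha] and the foot cannot return.

    Two pieces suffice: a helicoid first gives the line the right direction, and
    then a screw motion through a full turn, about an axis neither parallel nor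
    orthogonal to the line, produces any prescribed parallel translate. *)

(** * Derivatives and smoothness *)

Lemma is_derive_eq {V : NormedModule R_AbsRing} (f : R -> V) (t : R) (l m : V) :
  is_derive f t l -> l = m -> is_derive f t m.
Proof. intros hf <-; exact hf. Qed.

Lemma is_derive_linear {U V : NormedModule R_AbsRing} (phi : U -> V) (f : R -> U) t l :
  is_linear phi -> is_derive f t l -> is_derive (fun r => phi (f r)) t (phi l).
Proof.
intros hphi hf.
apply (filterdiff_ext_lin _ (fun y : R => phi (scal y l))).
- apply (filterdiff_comp f phi (fun y : R => scal y l) phi); [exact hf |].
  now apply filterdiff_linear.
- intros y; apply (linear_scal phi hphi).
Qed.

Lemma is_linear_inl {U V : NormedModule R_AbsRing} :
  @is_linear _ U (prod_NormedModule _ U V) (fun u => (u, zero)).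
Proof.
apply is_linear_prod; [| apply is_linear_zero].
split; try easy; exists 1; split; [lra | intros x; lra].
Qed.

Lemma is_linear_inr {U V : NormedModule R_AbsRing} :
  @is_linear _ V (prod_NormedModule _ U V) (fun v => (zero, v)).
Proof.
apply is_linear_prod; [apply is_linear_zero |].
split; try easy; exists 1; split; [lra | intros x; lra].
Qed.

Section Pair.
Context {U V : NormedModule R_AbsRing}.

(** The pair is the sum of its images under the two linear injections, so the rules for linear maps
    and for sums suffice. *)
Lemma is_derive_pair (f : R -> U) (g : R -> V) t lf lg :
  is_derive f t lf -> is_derive g t lg ->
  @is_derive _ (prod_NormedModule _ U V) (fun r => (f r, g r)) t (lf, lg).
Proof.
intros hf hg.
apply (is_derive_ext (V := prod_NormedModule _ U V)
  (fun r => plus ((f r, zero) : prod_NormedModule _ U V) (zero, g r))).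
- intros r; unfold plus; simpl; unfold prod_plus; simpl; now rewrite plus_zero_r, plus_zero_l.
- eapply is_derive_eq.
  + apply (is_derive_plus (V := prod_NormedModule _ U V)).
    * apply (is_derive_linear (V := prod_NormedModule _ U V) (fun u => (u, zero))).
      -- apply is_linear_inl.
      -- exact hf.
    * apply (is_derive_linear (V := prod_NormedModule _ U V) (fun v => (zero, v))).
      -- apply is_linear_inr.
      -- exact hg.
  + unfold plus; simpl; unfold prod_plus; simpl; now rewrite plus_zero_r, plus_zero_l.
Qed.

Lemma is_derive_fst (f : R -> prod_NormedModule _ U V) t l :
  is_derive f t l -> is_derive (fun r => fst (f r)) t (fst l).
Proof. intros hf; apply (is_derive_linear (fun p : prod_NormedModule _ U V => fst p)); [apply is_linear_fst | exact hf]. Qed.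

Lemma is_derive_snd (f : R -> prod_NormedModule _ U V) t l :
  is_derive f t l -> is_derive (fun r => snd (f r)) t (snd l).
Proof. intros hf; apply (is_derive_linear (fun p : prod_NormedModule _ U V => snd p)); [apply is_linear_snd | exact hf]. Qed.

Lemma Cn_pair n : forall (f : R -> U) (g : R -> V),
  Cn n f -> Cn n g -> Cn (V := prod_NormedModule _ U V) n (fun t => (f t, g t)).
Proof.
induction n as [|n IH]; simpl; intros f g.
- intros hf hg t.
  apply (continuous_comp_2 f g (fun u v => (u, v))); [apply hf | apply hg |].
  apply (continuous_ext (fun x => x)); [now intros [] | apply continuous_id].
- intros [f' [hf cf]] [g' [hg cg]].
  exists (fun t => (f' t, g' t)); split; [| now apply IH].
  intros t; now apply is_derive_pair.
Qed.

Lemma smooth_pair (f : R -> U) (g : R -> V) :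
  smooth f -> smooth g -> smooth (V := prod_NormedModule _ U V) (fun t => (f t, g t)).
Proof. intros hf hg n; now apply Cn_pair. Qed.

End Pair.

Lemma Cn_ext {V : NormedModule R_AbsRing} n (f g : R -> V) :
  (forall t, f t = g t) -> Cn n f -> Cn n g.
Proof.
destruct n as [|n]; simpl; intros e.
- intros hf t; now apply (continuous_ext f).
- intros [f' [hf cf]]; exists f'; split; [| exact cf].
  intros t; now apply (is_derive_ext f).
Qed.

Lemma Cn_pred {V : NormedModule R_AbsRing} n : forall f : R -> V, Cn (S n) f -> Cn n f.
Proof.
induction n as [|n IH]; intros f [f' [hf cf]].
- intros t; apply ex_derive_continuous; eexists; apply hf.
- exists f'; split; [exact hf | now apply IH].
Qed.

Lemma smooth_continuous {V : NormedModule R_AbsRing} (f : R -> V) t :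
  smooth f -> continuous f t.
Proof. intros hf; exact (hf O t). Qed.

Lemma smooth_ex_derive {V : NormedModule R_AbsRing} (f : R -> V) t :
  smooth f -> exists l, is_derive f t l.
Proof. intros hf; destruct (hf 1%nat) as [f' [h _]]; exists (f' t); apply h. Qed.

Lemma Cn_const n : forall c : R, Cn n (fun _ : R => c).
Proof.
induction n as [|n IH]; intros c; simpl.
- intros t; apply continuous_const.
- exists (fun _ => 0); split; [intros t; apply (is_derive_const (V := R_NormedModule)) | apply IH].
Qed.

Lemma Cn_plus n : forall f g : R -> R, Cn n f -> Cn n g -> Cn n (fun t => f t + g t).
Proof.
induction n as [|n IH]; simpl; intros f g.
- intros hf hg t; apply (continuous_plus (V := R_NormedModule)); [apply hf | apply hg].
- intros [f' [hf cf]] [g' [hg cg]].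
  exists (fun t => f' t + g' t); split; [| now apply IH].
  intros t; apply (is_derive_plus (V := R_NormedModule)); [apply hf | apply hg].
Qed.

(** The derivative [f' g + f g'] also contains [f] and [g] themselves, which the induction needs at
    the lower order; [Cn_pred] provides them. *)
Lemma Cn_mult n : forall f g : R -> R, Cn n f -> Cn n g -> Cn n (fun t => f t * g t).
Proof.
induction n as [|n IH]; intros f g.
- simpl; intros hf hg t; apply (continuous_mult (K := R_AbsRing)); [apply hf | apply hg].
- intros Hf Hg; pose proof (Cn_pred _ _ Hf) as hf0; pose proof (Cn_pred _ _ Hg) as hg0.
  destruct Hf as [f' [hf cf]], Hg as [g' [hg cg]].
  exists (fun t => f' t * g t + f t * g' t); split.
  + intros t; apply Derive.is_derive_mult; [apply hf | apply hg].
  + apply Cn_plus; now apply IH.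
Qed.

Lemma smooth_const (c : R) : smooth (fun _ : R => c).
Proof. intros n; apply Cn_const. Qed.

Lemma smooth_plus (f g : R -> R) : smooth f -> smooth g -> smooth (fun t => f t + g t).
Proof. intros hf hg n; now apply Cn_plus. Qed.

Lemma smooth_mult (f g : R -> R) : smooth f -> smooth g -> smooth (fun t => f t * g t).
Proof. intros hf hg n; now apply Cn_mult. Qed.

Lemma smooth_opp (f : R -> R) : smooth f -> smooth (fun t => - f t).
Proof.
intros hf n; apply (Cn_ext n (fun t => - (1) * f t)); [intros t; change (- (1) * f t = - f t :> R); ring |].
apply Cn_mult; [apply Cn_const | apply hf].
Qed.

Lemma smooth_minus (f g : R -> R) : smooth f -> smooth g -> smooth (fun t => f t - g t).
Proof. intros hf hg; apply smooth_plus; [exact hf | now apply smooth_opp]. Qed.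

Lemma smooth_id : smooth (fun t : R => t).
Proof.
intros [|n]; simpl.
- intros t; apply continuous_id.
- exists (fun _ => 1); split; [intros t; apply (is_derive_id (K := R_AbsRing) t) | apply Cn_const].
Qed.

(** Each function is the derivative of the other up to a constant factor, hence the joint
    induction. *)
Lemma Cn_cos_sin (w : R) n : Cn n (fun t => cos (w * t)) /\ Cn n (fun t => sin (w * t)).
Proof.
induction n as [|n [IHc IHs]].
- split; intros t; apply (ex_derive_continuous (V := R_NormedModule)); auto_derive; easy.
- split.
  + exists (fun t => (- w) * sin (w * t)); split; [| apply Cn_mult; [apply Cn_const | exact IHs]].
    intros t; auto_derive; [easy | ring].
  + exists (fun t => w * cos (w * t)); split; [| apply Cn_mult; [apply Cn_const | exact IHc]].
    intros t; auto_derive; [easy | ring].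
Qed.

Lemma smooth_cos (w : R) : smooth (fun t => cos (w * t)).
Proof. intros n; apply Cn_cos_sin. Qed.

Lemma smooth_sin (w : R) : smooth (fun t => sin (w * t)).
Proof. intros n; apply Cn_cos_sin. Qed.

(** * Coordinatewise calculus of curves in space *)

Lemma smooth_vec (f : R -> vec) :
  smooth (fun t => cx (f t)) -> smooth (fun t => cy (f t)) -> smooth (fun t => cz (f t)) ->
  smooth f.
Proof.
intros hx hy hz n.
apply (Cn_ext (V := vec) n (fun t => (cx (f t), cy (f t), cz (f t)))).
- intros t; now destruct (f t) as [[a b] c].
- apply Cn_pair; [apply Cn_pair |]; [apply hx | apply hy | apply hz].
Qed.

Lemma is_derive_vec (f : R -> vec) t (l : vec) :
  is_derive f t l <->
  is_derive (fun r => cx (f r)) t (cx l) /\ is_derive (fun r => cy (f r)) t (cy l) /\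
  is_derive (fun r => cz (f r)) t (cz l).
Proof.
split.
- intros h.
  pose proof (is_derive_fst (U := prod_NormedModule _ R_NormedModule R_NormedModule)
    (V := R_NormedModule) f t l h) as h1.
  split; [| split].
  + exact (is_derive_fst (U := R_NormedModule) (V := R_NormedModule) _ _ _ h1).
  + exact (is_derive_snd (U := R_NormedModule) (V := R_NormedModule) _ _ _ h1).
  + exact (is_derive_snd (U := prod_NormedModule _ R_NormedModule R_NormedModule)
      (V := R_NormedModule) f t l h).
- intros [hx [hy hz]].
  apply (is_derive_ext (V := vec) (fun t => (cx (f t), cy (f t), cz (f t)))).
  + intros r; now destruct (f r) as [[a b] c].
  + destruct l as [[a b] c]; apply is_derive_pair; [apply is_derive_pair |]; assumption.
Qed.

Lemma is_derive_unique_vec (f : R -> vec) t (l m : vec) :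
  is_derive f t l -> is_derive f t m -> l = m.
Proof.
intros hl hm; apply is_derive_vec in hl; apply is_derive_vec in hm.
destruct hl as [a [b c]], hm as [a' [b' c']]; apply vec_ext.
- now rewrite <- (is_derive_unique _ _ _ a), <- (is_derive_unique _ _ _ a').
- now rewrite <- (is_derive_unique _ _ _ b), <- (is_derive_unique _ _ _ b').
- now rewrite <- (is_derive_unique _ _ _ c), <- (is_derive_unique _ _ _ c').
Qed.

Lemma is_derive_dot (f g : R -> vec) t (lf lg : vec) :
  is_derive f t lf -> is_derive g t lg ->
  is_derive (fun r => dot (f r) (g r)) t (dot lf (g t) + dot (f t) lg).
Proof.
intros hf hg; apply is_derive_vec in hf; apply is_derive_vec in hg.
destruct hf as [a [b c]], hg as [a' [b' c']].
unfold dot; eapply is_derive_eq.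
- apply (is_derive_plus (V := R_NormedModule)); [apply (is_derive_plus (V := R_NormedModule)) |];
    apply Derive.is_derive_mult; eassumption.
- unfold plus; simpl; ring.
Qed.

Lemma is_derive_vscal (k : R -> R) (f : R -> vec) t lk (lf : vec) :
  is_derive k t lk -> is_derive f t lf ->
  is_derive (fun r => vscal (k r) (f r)) t (vadd (vscal lk (f t)) (vscal (k t) lf)).
Proof.
intros hk hf; apply is_derive_vec in hf; destruct hf as [a [b c]]; apply is_derive_vec.
split; [| split]; [exact (Derive.is_derive_mult _ _ _ _ _ hk a) |
  exact (Derive.is_derive_mult _ _ _ _ _ hk b) | exact (Derive.is_derive_mult _ _ _ _ _ hk c)].
Qed.

Lemma is_derive_vsub (f g : R -> vec) t (lf lg : vec) :
  is_derive f t lf -> is_derive g t lg ->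
  is_derive (fun r => vsub (f r) (g r)) t (vsub lf lg).
Proof. apply (is_derive_minus (V := vec)). Qed.

Lemma has_velocity_pair (gamma : R -> oline) t (X : ambient) :
  has_velocity gamma t X <->
  is_derive (fun r => dir (gamma r)) t (fst X) /\ is_derive (fun r => foot (gamma r)) t (snd X).
Proof.
unfold has_velocity, emb; split.
- intros h; split.
  + exact (is_derive_fst (U := vec) (V := vec) _ _ _ h).
  + exact (is_derive_snd (U := vec) (V := vec) _ _ _ h).
- intros [h1 h2]; destruct X as [X1 X2]; exact (is_derive_pair (U := vec) (V := vec) _ _ _ _ _ h1 h2).
Qed.

(** * Euclidean geometry *)

Ltac vring := apply vec_ext; vec_simpl; ring.
Ltac dring := vec_simpl; ring.

Lemma dot_comm (u v : vec) : dot u v = dot v u.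
Proof. dring. Qed.

Lemma dot_vadd_l (u v w : vec) : dot (vadd u v) w = dot u w + dot v w.
Proof. dring. Qed.

Lemma dot_vsub_l (u v w : vec) : dot (vsub u v) w = dot u w - dot v w.
Proof. dring. Qed.

Lemma dot_vscal_l k (u v : vec) : dot (vscal k u) v = k * dot u v.
Proof. dring. Qed.

Lemma dot_vadd_r (u v w : vec) : dot u (vadd v w) = dot u v + dot u w.
Proof. dring. Qed.

Lemma dot_vsub_r (u v w : vec) : dot u (vsub v w) = dot u v - dot u w.
Proof. dring. Qed.

Lemma dot_vscal_r k (u v : vec) : dot u (vscal k v) = k * dot u v.
Proof. dring. Qed.

Lemma dot_cross_l (u v : vec) : dot (cross u v) u = 0.
Proof. dring. Qed.

Lemma dot_cross_r (u v : vec) : dot (cross u v) v = 0.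
Proof. dring. Qed.

Lemma dot_cross_cross (u v w z : vec) :
  dot (cross u v) (cross w z) = dot u w * dot v z - dot u z * dot v w.
Proof. dring. Qed.

Lemma cross_vscal_r k (u v : vec) : cross u (vscal k v) = vscal k (cross u v).
Proof. vring. Qed.

Lemma cross_cross_l (u v w : vec) :
  cross u (cross v w) = vsub (vscal (dot u w) v) (vscal (dot u v) w).
Proof. vring. Qed.

Lemma cross_cross_r (u v w : vec) :
  cross (cross u v) w = vsub (vscal (dot u w) v) (vscal (dot v w) u).
Proof. vring. Qed.

Ltac dots := repeat first [rewrite dot_vadd_l | rewrite dot_vadd_r | rewrite dot_vsub_l
  | rewrite dot_vsub_r | rewrite dot_vscal_l | rewrite dot_vscal_r].

Lemma orthonormal_expansion (v b w : vec) :
  dot v v = 1 -> dot b b = 1 -> dot v b = 0 ->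
  w = vadd (vadd (vscal (dot w v) v) (vscal (dot w b) b))
           (vscal (dot w (cross v b)) (cross v b)).
Proof.
intros hv hb hvb.
(* A polynomial identity for arbitrary [v] and [b], with their Gram determinant on the left; the
   hypotheses turn that determinant into 1. *)
assert (gram : vscal (dot v v * dot b b - dot v b * dot v b) w =
  vadd (vadd (vscal (dot w v) (vsub (vscal (dot b b) v) (vscal (dot v b) b)))
             (vscal (dot w b) (vsub (vscal (dot v v) b) (vscal (dot v b) v))))
       (vscal (dot w (cross v b)) (cross v b))).
{ clear; vring. }
rewrite hv, hb, hvb in gram.
transitivity (vscal (1 * 1 - 0 * 0) w); [clear; vring | rewrite gram; clear; vring].
Qed.

Lemma unit_orthogonal (v : vec) : exists m, dot m m = 1 /\ dot m v = 0.
Proof.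
destruct (Req_dec (cx v * cx v + cy v * cy v) 0) as [h | h].
(* A vertical [v] is orthogonal to [e1]; otherwise the horizontal vector [(- cy v, cx v, 0)] can be
   normalized. *)
- exists e1; assert (hx : cx v = 0) by nra.
  unfold dot, e1, mkvec; split; [| rewrite hx]; vec_simpl; ring.
- set (k := cx v * cx v + cy v * cy v) in *.
  assert (hk : 0 < k) by (unfold k in *; nra).
  pose proof (sqrt_lt_R0 _ hk) as hs; pose proof (sqrt_sqrt k (Rlt_le _ _ hk)) as hss.
  exists (vscal (/ sqrt k) (mkvec (- cy v) (cx v) 0)); dots; split.
  + replace (dot (mkvec (- cy v) (cx v) 0) (mkvec (- cy v) (cx v) 0)) with (sqrt k * sqrt k);
      [field; lra | rewrite hss; unfold k; clear; dring].
  + replace (dot (mkvec (- cy v) (cx v) 0) v) with 0; [ring | clear; dring].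
Qed.

Lemma enorm_sqr (u : vec) : enorm u * enorm u = dot u u.
Proof. unfold enorm; apply sqrt_sqrt; unfold dot; nra. Qed.

Lemma dot_self_0 (u : vec) : dot u u = 0 -> u = vzero.
Proof.
intros h; unfold dot in h.
assert (hx : cx u = 0) by nra; assert (hy : cy u = 0) by nra; assert (hz : cz u = 0) by nra.
apply vec_ext; assumption.
Qed.

(** The zero vector is polarised along an arbitrary [m]. *)
Lemma polar (d v : vec) :
  dot d v = 0 -> exists m, dot m m = 1 /\ dot m v = 0 /\ d = vscal (enorm d) m.
Proof.
intros hd; pose proof (enorm_sqr d) as hs.
destruct (Req_dec (enorm d) 0) as [h | h].
- destruct (unit_orthogonal v) as [m [hm hmv]].
  exists m; split; [exact hm | split; [exact hmv |]].
  rewrite h in hs; rewrite h, (dot_self_0 d) by lra; clear; vring.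
- exists (vscal (/ enorm d) d); dots; split; [| split].
  + rewrite <- hs; now field.
  + rewrite hd; ring.
  + transitivity (vscal (enorm d * / enorm d) d); [| clear; vring].
    rewrite Rinv_r by exact h; clear; vring.
Qed.

(** * Oriented lines and admissible vectors *)

(** For unit [v], this is the foot of the line through [q] with direction [v]. *)
Definition normal_part (v q : vec) : vec := vsub q (vscal (dot q v) v).

Lemma normal_part_orth (v q : vec) : enorm v = 1 -> dot (normal_part v q) v = 0.
Proof. intros hv; apply enorm_1 in hv; unfold normal_part; dots; rewrite hv; ring. Qed.

Definition line (q v : vec) (hv : enorm v = 1) : oline :=
  mk_oline v (normal_part v q) hv (normal_part_orth v q hv).

(** Turns the relation [represents] into an equation, so that a curve of lines can be differentiated
    through an explicit formula. *)
Lemma represents_line (sigma : R -> vec) (q v : vec) (hv : enorm v = 1) (l : oline) :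
  (forall s, sigma s = vadd q (vscal s v)) -> represents sigma l <-> l = line q v hv.
Proof.
intros hs; assert (hr : represents sigma (line q v hv)).
{ exists (dot q v); intros s; rewrite hs; unfold point, line, normal_part; simpl.
  clear; vring. }
split; [intros h; exact (represents_unique _ _ _ h hr) | now intros ->].
Qed.

Lemma is_derive_normal_part (v q : R -> vec) t v' q' :
  is_derive v t v' -> is_derive q t q' ->
  is_derive (fun r => normal_part (v r) (q r)) t
    (vsub q' (vadd (vscal (dot q' (v t) + dot (q t) v') (v t)) (vscal (dot (q t) (v t)) v'))).
Proof.
intros hv hq; apply is_derive_vsub; [exact hq |].
apply is_derive_vscal; [| exact hv]; now apply is_derive_dot.
Qed.

(** * Initial velocities of helicoidal curves *)

Section Helicoid.
Variables (alpha : R) (l : oline) (p A : vec).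
Hypotheses (hA : dot A A = 1) (hAl : dot A (dir l) = 0).

Let v := dir l.
Let B := cross A v.

Definition helicoid_dir (t : R) : vec :=
  vadd (vscal (cos (alpha * t)) v) (vscal (sin (alpha * t)) B).

Definition helicoid_point (t : R) : vec := vadd p (vscal t A).

Lemma helicoid_frame : dot v v = 1 /\ dot B B = 1 /\ dot v B = 0 /\ cross v B = A.
Proof.
assert (hv : dot v v = 1) by (apply enorm_1, dir_unit).
fold v in hAl; split; [exact hv | split; [| split]]; unfold B.
- rewrite dot_cross_cross, hA, hv, hAl; ring.
- rewrite dot_comm; apply dot_cross_r.
- rewrite cross_cross_l, hv, (dot_comm v A), hAl; clear; vring.
Qed.

Lemma helicoid_dir_unit t : enorm (helicoid_dir t) = 1.
Proof.
destruct helicoid_frame as [hv [hB [hvB _]]].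
apply enorm_1; unfold helicoid_dir; dots; rewrite hv, hB, (dot_comm B v), hvB.
pose proof (sin2_cos2 (alpha * t)) as h; unfold Rsqr in h; lra.
Qed.

(** The foot moves with velocity [A] up to corrections along [v] and [B] that come from projecting
    orthogonally to the turning direction. The one along [B] depends on the position [dot p v] of
    [p] on the line. *)
Lemma helicoid_velocity (Gamma : R -> oline) :
  (forall t, Gamma t = line (helicoid_point t) (helicoid_dir t) (helicoid_dir_unit t)) ->
  has_velocity Gamma 0
    (vscal alpha B, vsub (vsub A (vscal (alpha * dot p B) v)) (vscal (alpha * dot p v) B)).
Proof.
intros hG.
assert (h0 : helicoid_dir 0 = v).
{ unfold helicoid_dir; rewrite Rmult_0_r, cos_0, sin_0; clear; vring. }
assert (hp0 : helicoid_point 0 = p) by (unfold helicoid_point; clear; vring).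
assert (hd : is_derive helicoid_dir 0 (vscal alpha B)).
{ eapply is_derive_eq.
  - apply (is_derive_plus (V := vec)).
    + apply (is_derive_vscal (fun t => cos (alpha * t)) (fun _ => v) 0 0 vzero).
      * auto_derive; [easy |]; rewrite Rmult_0_r, sin_0; ring.
      * apply (is_derive_const (V := vec)).
    + apply (is_derive_vscal (fun t => sin (alpha * t)) (fun _ => B) 0 alpha vzero).
      * auto_derive; [easy |]; rewrite Rmult_0_r, cos_0; ring.
      * apply (is_derive_const (V := vec)).
  - rewrite Rmult_0_r, sin_0, cos_0; clear; vring. }
assert (hp : is_derive helicoid_point 0 A).
{ eapply is_derive_eq.
  - apply (is_derive_plus (V := vec) (fun _ => p) (fun t => vscal t A) 0 vzero);
      [apply (is_derive_const (V := vec)) |].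
    apply (is_derive_vscal (fun t => t) (fun _ => A) 0 1 vzero).
    + apply (is_derive_id (K := R_AbsRing)).
    + apply (is_derive_const (V := vec)).
  - clear; vring. }
apply has_velocity_pair; split.
- apply (is_derive_ext (V := vec) helicoid_dir); [| exact hd].
  intros t; rewrite hG; reflexivity.
- apply (is_derive_ext (V := vec) (fun t => normal_part (helicoid_dir t) (helicoid_point t))).
  { intros t; rewrite hG; reflexivity. }
  eapply is_derive_eq; [apply (is_derive_normal_part _ _ _ _ _ hd hp) |].
  rewrite h0, hp0, dot_vscal_r.
  fold v in hAl; rewrite hAl; simpl; clear; vring.
Qed.

End Helicoid.

(** With [B = cross A v], the direction turns with velocity [alpha B], so [v x v' = alpha A], while
    the component of [u'] along [A] is 1. *)
Lemma admissible_vector_inv (alpha : R) (l : oline) (X : ambient) :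
  admissible_vector alpha l X ->
  dot (snd X) (cross (dir l) (fst X)) = alpha.
Proof.
intros [p [A [Gamma [[hp [hA [hAl hG]]] hX]]]].
apply enorm_1 in hA.
destruct (helicoid_frame l A hA hAl) as [hv [hB [hvB hvBA]]].
assert (hG' : forall t, Gamma t =
  line (helicoid_point p A t) (helicoid_dir alpha l A t) (helicoid_dir_unit alpha l A hA hAl t)).
{ intros t; apply (represents_line _ _ _ _ _ (fun s => eq_refl) ), hG. }
pose proof (helicoid_velocity alpha l p A hA hAl Gamma hG') as hY.
apply has_velocity_pair in hX; apply has_velocity_pair in hY.
rewrite (is_derive_unique_vec _ _ _ _ (proj1 hX) (proj1 hY)).
rewrite (is_derive_unique_vec _ _ _ _ (proj2 hX) (proj2 hY)).
simpl; rewrite cross_vscal_r, hvBA; dots.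
rewrite hA, (dot_comm (dir l) A), hAl, dot_cross_l; ring.
Qed.

(** The first two equations express tangency to [TS^2]. The frame of the helicoid is read off [v'],
    and the last equation makes the component of [u'] along [A] equal to 1. *)
Lemma admissible_vector_intro (alpha : R) (l : oline) (X : ambient) :
  alpha <> 0 ->
  dot (dir l) (fst X) = 0 ->
  dot (snd X) (dir l) + dot (foot l) (fst X) = 0 ->
  dot (fst X) (fst X) = alpha * alpha ->
  dot (snd X) (cross (dir l) (fst X)) = alpha ->
  admissible_vector alpha l X.
Proof.
intros ha h1 h2 h3 h4.
set (b := vscal (/ alpha) (fst X)).
assert (hX1 : fst X = vscal alpha b).
{ transitivity (vscal (alpha * / alpha) (fst X)); [| unfold b; clear; vring].
  rewrite Rinv_r by exact ha; clear; vring. }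
assert (hv : dot (dir l) (dir l) = 1) by (apply enorm_1, dir_unit).
assert (hb : dot b b = 1) by (unfold b; dots; rewrite h3; now field).
assert (hvb : dot (dir l) b = 0) by (unfold b; dots; rewrite h1; ring).
set (A := cross (dir l) b).
assert (hA : dot A A = 1).
{ unfold A; rewrite dot_cross_cross, hv, hb, hvb; ring. }
assert (hAl : dot A (dir l) = 0) by apply dot_cross_l.
assert (hB : cross A (dir l) = b).
{ unfold A; rewrite cross_cross_r, hv, (dot_comm b), hvb; clear; vring. }
(* The velocity of the helicoid has component [- alpha * dot p v = - alpha * s0] along [b]; this
   choice of [p] matches it with that of [snd X]. *)
set (s0 := - dot (snd X) b / alpha); set (p := point l s0).
exists p, A, (fun t => line (helicoid_point p A t) (helicoid_dir alpha l A t)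
  (helicoid_dir_unit alpha l A hA hAl t)); split.
- split; [now exists s0 | split; [now apply enorm_1 | split; [exact hAl |]]].
  intros t; apply (represents_line _ _ _ (helicoid_dir_unit alpha l A hA hAl t) _
    (fun s => eq_refl)); reflexivity.
- pose proof (helicoid_velocity alpha l p A hA hAl _ (fun t => eq_refl)) as h.
  match type of h with has_velocity _ _ ?Y => replace X with Y; [exact h |] end.
  rewrite hB, <- hX1.
  assert (hp1 : dot p b = dot (foot l) b).
  { unfold p, point; dots; rewrite hvb; ring. }
  assert (hp2 : dot p (dir l) = s0).
  { unfold p, point; dots; rewrite hv, (foot_orth l); ring. }
  rewrite hp1, hp2.
  assert (h4' : dot (snd X) A = 1).
  { rewrite hX1, cross_vscal_r, dot_vscal_r in h4; fold A in h4.
    apply (Rmult_eq_reg_l alpha); [lra | exact ha]. }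
  assert (h2' : dot (snd X) (dir l) = - (alpha * dot (foot l) b)).
  { rewrite hX1, dot_vscal_r in h2; lra. }
  assert (hs : alpha * s0 = - dot (snd X) b) by (unfold s0; now field).
  rewrite hs; destruct X as [X1 X2]; simpl in *; f_equal.
  rewrite (orthonormal_expansion (dir l) b X2 hv hb hvb) at 2.
  fold A; rewrite h4', h2'; generalize A (dir l) (foot l); clear; intros; vring.
Qed.

(** * One-parameter groups of isometries *)

Lemma isometry_dot (g : vec -> vec) (o x y : vec) :
  isometry g -> dot (vsub (g x) (g o)) (vsub (g y) (g o)) = dot (vsub x o) (vsub y o).
Proof.
intros hg.
assert (hn : forall a b, dot (vsub (g a) (g b)) (vsub (g a) (g b)) = dot (vsub a b) (vsub a b)).
{ intros a b; now rewrite <- !enorm_sqr, hg. }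
assert (polarization : forall a b c, 2 * dot (vsub a c) (vsub b c) =
  dot (vsub a c) (vsub a c) + dot (vsub b c) (vsub b c) - dot (vsub a b) (vsub a b)).
{ clear; intros; dring. }
apply (Rmult_eq_reg_l 2); [| lra]; now rewrite !polarization, !hn.
Qed.

(** The squared norm of the difference of the two sides expands into inner products of images, which
    [isometry_dot] replaces by those of the original vectors; it is therefore 0. *)
Lemma isometry_affine (g : vec -> vec) (x : vec) :
  isometry g ->
  vsub (g x) (g vzero) =
  vadd (vadd (vscal (cx x) (vsub (g e1) (g vzero))) (vscal (cy x) (vsub (g e2) (g vzero))))
       (vscal (cz x) (vsub (g e3) (g vzero))).
Proof.
intros hg.
pose proof (fun a b => isometry_dot g vzero a b hg) as hd.
set (r := fun a => vsub (g a) (g vzero)).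
change (forall a b, dot (r a) (r b) = dot (vsub a vzero) (vsub b vzero)) in hd.
change (r x = vadd (vadd (vscal (cx x) (r e1)) (vscal (cy x) (r e2))) (vscal (cz x) (r e3))).
set (y := vadd _ _).
assert (h : vsub (r x) y = vzero).
{ apply dot_self_0; unfold y; dots; rewrite !hd.
  unfold vzero, e1, e2, e3; clear; dring. }
transitivity (vadd (vsub (r x) y) y); [| rewrite h]; generalize (r x) y; clear; intros; vring.
Qed.

(** The linear part of [g t] is orthogonal, so its derivative at 0 is skew, that is, a cross product
    with a fixed vector; the group law carries this to every time. *)
Lemma one_parameter_group_angular_velocity (g : R -> vec -> vec) :
  one_parameter_group g ->
  exists omega, forall x y t,
    is_derive (fun r => vsub (g r x) (g r y)) t (cross omega (vsub (g t x) (g t y))).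
Proof.
intros [hrig [h0 [hadd hsm]]].
(* [E a t] is the linear part of [g t] applied to [a]. *)
set (E := fun a t => vsub (g t a) (g t vzero)).
assert (hE : forall a, exists a', is_derive (E a) 0 a').
{ intros a; destruct (smooth_ex_derive _ 0 (hsm a)) as [p hp].
  destruct (smooth_ex_derive _ 0 (hsm vzero)) as [q hq].
  exists (vsub p q); now apply is_derive_vsub. }
assert (hE0 : forall a, E a 0 = a) by (intros a; unfold E; rewrite !h0; clear; vring).
(* The inner product of [E a t] and [E b t] does not depend on [t]; its derivative at 0 vanishes. *)
assert (skew : forall a b a' b', is_derive (E a) 0 a' -> is_derive (E b) 0 b' ->
  dot a' b + dot a b' = 0).
{ intros a b a' b' ha hb.
  rewrite <- (hE0 a), <- (hE0 b).
  rewrite <- (is_derive_unique _ _ _ (is_derive_dot _ _ _ _ _ ha hb)).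
  rewrite (Derive_ext _ (fun _ => dot (vsub a vzero) (vsub b vzero))).
  - apply Derive_const.
  - intros t; apply isometry_dot, hrig. }
destruct (hE e1) as [a1 h1], (hE e2) as [a2 h2], (hE e3) as [a3 h3].
(* The entries of the skew matrix with columns [a1], [a2], [a3] that determine its axial vector. *)
exists (mkvec (cz a2) (cx a3) (cy a1)); intros x y t.
set (d := vsub (g t x) (g t y)).
(* Since [g r] is [g (r - t)] after [g t], the difference at time [r] is the linear part at time
   [r - t] applied to the fixed vector [d]. *)
apply (is_derive_ext (V := vec) (fun r => vadd (vadd (vscal (cx d) (E e1 (r - t)))
  (vscal (cy d) (E e2 (r - t)))) (vscal (cz d) (E e3 (r - t))))).
{ intros r; replace r with ((r - t) + t) at 4 5 by ring; rewrite !hadd.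
  pose proof (isometry_affine (g (r - t)) (g t x) (proj1 (hrig (r - t)))) as hx.
  pose proof (isometry_affine (g (r - t)) (g t y) (proj1 (hrig (r - t)))) as hy.
  transitivity (vsub (vsub (g (r - t) (g t x)) (g (r - t) vzero))
                     (vsub (g (r - t) (g t y)) (g (r - t) vzero))); [| clear; vring].
  rewrite hx, hy; unfold E, d; clear; vring. }
assert (hc : forall a a' k, is_derive (E a) 0 a' ->
  is_derive (fun r => vscal k (E a (r - t))) t (vscal k a')).
{ intros a a' k ha; eapply is_derive_eq.
  - apply (is_derive_vscal (fun _ => k) (fun r => E a (r - t)) t 0 a').
    + apply (is_derive_const (V := R_NormedModule)).
    + eapply is_derive_eq.
      * apply (is_derive_comp (V := vec) (E a) (fun r => r - t) t a' 1).
        -- rewrite Rminus_diag; exact ha.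
        -- auto_derive; [easy | ring].
      * apply (scal_one (V := vec)).
  - clear; vring. }
eapply is_derive_eq.
- apply (is_derive_plus (V := vec)); [apply (is_derive_plus (V := vec)) |];
    apply hc; eassumption.
- pose proof (skew _ _ _ _ h1 h1) as s11; pose proof (skew _ _ _ _ h2 h2) as s22.
  pose proof (skew _ _ _ _ h3 h3) as s33; pose proof (skew _ _ _ _ h1 h2) as s12.
  pose proof (skew _ _ _ _ h1 h3) as s13; pose proof (skew _ _ _ _ h2 h3) as s23.
  clearbody d; unfold e1, e2, e3 in *; clear - s11 s22 s33 s12 s13 s23.
  destruct a1 as [[p1 p2] p3], a2 as [[q1 q2] q3], a3 as [[r1 r2] r3], d as [[d1 d2] d3].
  vec_simpl.
  replace p1 with 0 by lra; replace q2 with 0 by lra; replace r3 with 0 by lra.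
  replace q1 with (- p2) by lra; replace p3 with (- r1) by lra; replace r2 with (- q3) by lra.
  apply vec_ext; vec_simpl; ring.
Qed.

(** * Orbits cannot reverse an admissible line *)

Lemma is_derive_0_constant (f : R -> R) :
  (forall t, is_derive f t 0) -> forall a b, f a = f b.
Proof.
intros hf a b; destruct (Rtotal_order a b) as [h | [h | h]].
- apply (eq_is_derive (V := R_NormedModule)); [intros; apply hf | exact h].
- now rewrite h.
- symmetry; apply (eq_is_derive (V := R_NormedModule)); [intros; apply hf | exact h].
Qed.

Lemma represents_dir (sigma : R -> vec) (l : oline) :
  represents sigma l -> dir l = vsub (sigma 1) (sigma 0).
Proof. intros [s0 hs]; rewrite !hs; unfold point; clear; vring. Qed.

Lemma Hfam_no_reversal (alpha : R) (f : R -> oline) (a b : R) :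
  Hfam alpha f -> a < b ->
  dir (f b) = vscal (-1) (dir (f a)) -> foot (f b) = foot (f a) -> alpha = 0.
Proof.
intros [[g [l [hg hl]]] [_ hadm]] hab hdir hfoot.
destruct (one_parameter_group_angular_velocity g hg) as [omega hom].
assert (hv : forall t, is_derive (fun r => dir (f r)) t (cross omega (dir (f t)))).
{ intros t; rewrite (represents_dir _ _ (hl t)).
  apply (is_derive_ext (V := vec) (fun r => vsub (g r (point l 1)) (g r (point l 0)))).
  - intros r; now rewrite (represents_dir _ _ (hl r)).
  - apply hom. }
assert (hc : forall s t, dot omega (dir (f s)) = dot omega (dir (f t))).
{ apply (is_derive_0_constant (fun t => dot omega (dir (f t)))); intros t.
  eapply is_derive_eq.
  - apply (is_derive_dot (fun _ => omega) _ t vzero); [apply (is_derive_const (V := vec)) | apply hv].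
  - rewrite (dot_comm omega), dot_cross_l; unfold vzero; clear; dring. }
(* The conserved quantity takes opposite values at [a] and [b]. *)
assert (ho : forall t, dot omega (dir (f t)) = 0).
{ intros t; pose proof (hc a b) as h; rewrite hdir, dot_vscal_r in h.
  rewrite (hc t a); lra. }
(* As [omega] is orthogonal to [v], [cross v (cross omega v)] is [omega], and admissibility reads
   [dot u' omega = alpha]. *)
assert (hX : forall t, is_derive (fun r => dot (foot (f r)) omega - alpha * r) t 0).
{ intros t; destruct (hadm t) as [X [hX hXa]].
  apply admissible_vector_inv in hXa; apply has_velocity_pair in hX.
  destruct hX as [hX1 hX2].
  rewrite (is_derive_unique_vec _ _ _ _ hX1 (hv t)), cross_cross_l in hXa.
  rewrite (proj1 (enorm_1 _) (dir_unit (f t))), (dot_comm _ omega), ho in hXa.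
  eapply is_derive_eq.
  - apply (is_derive_minus (V := R_NormedModule)).
    + apply (is_derive_dot _ (fun _ => omega) t _ vzero hX2).
      apply (is_derive_const (V := vec)).
    + apply (is_derive_scal (fun r => r) t alpha 1), (is_derive_id (K := R_AbsRing)).
  - rewrite <- hXa; unfold vzero; clear; dring. }
pose proof (is_derive_0_constant _ hX a b) as h; simpl in h; rewrite hfoot in h.
apply (Rmult_eq_reg_r (b - a)); lra.
Qed.

(** * Screw motions *)

(** Rodrigues' formula for the rotation by the angle [th] about a unit vector [n]. *)
Definition rot (n : vec) (th : R) (y : vec) : vec :=
  vadd (vadd (vscal (cos th) y) (vscal (sin th) (cross n y)))
       (vscal ((1 - cos th) * dot n y) n).

(** The axis passes through [q] with direction [n]; [w] is the angular speed and [h] the speed of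
    translation along the axis. *)
Definition screw (n q : vec) (w h t : R) (x : vec) : vec :=
  vadd (vadd q (vscal (t * h) n)) (rot n (w * t) (vsub x q)).

(** The infinitesimal generator of [screw n q w h]. *)
Definition screw_field (n q : vec) (w h : R) (x : vec) : vec :=
  vadd (vscal h n) (vscal w (cross n (vsub x q))).

Lemma rot_trivial (n : vec) (th : R) (y : vec) : cos th = 1 -> sin th = 0 -> rot n th y = y.
Proof. intros hc hs; unfold rot; rewrite hc, hs; clear; vring. Qed.

Lemma rot_vsub (n : vec) (th : R) (x y : vec) :
  rot n th (vsub x y) = vsub (rot n th x) (rot n th y).
Proof. unfold rot; generalize (cos th) (sin th); intros; vring. Qed.

Lemma rot_vadd (n : vec) (th : R) (x y : vec) :
  rot n th (vadd x y) = vadd (rot n th x) (rot n th y).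
Proof. unfold rot; generalize (cos th) (sin th); intros; vring. Qed.

Lemma rot_vscal (n : vec) (th k : R) (x : vec) :
  rot n th (vscal k x) = vscal k (rot n th x).
Proof. unfold rot; generalize (cos th) (sin th); intros; vring. Qed.

Lemma rot_cross_axis (n : vec) (th : R) (y : vec) :
  rot n th (cross n y) = cross n (rot n th y).
Proof. unfold rot; generalize (cos th) (sin th); intros; vring. Qed.

Section Rotation.
Variable n : vec.
Hypothesis hn : dot n n = 1.

Lemma rot_axis th : rot n th n = n.
Proof. unfold rot; rewrite hn; generalize (cos th) (sin th); clear; intros; vring. Qed.

Lemma rot_dot th x y : dot (rot n th x) (rot n th y) = dot x y.
Proof.
pose proof (sin2_cos2 th) as hcs; unfold Rsqr in hcs.
unfold rot; revert hcs; generalize (cos th) (sin th); intros c s hcs.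
(* A polynomial identity in which neither [dot n n = 1] nor [c * c + s * s = 1] has been used
   yet. *)
transitivity (c * c * dot x y + s * s * (dot n n * dot x y - dot n x * dot n y)
  + dot n x * dot n y * (2 * c * (1 - c) + dot n n * ((1 - c) * (1 - c)))).
- clear; dring.
- rewrite hn; replace (s * s) with (1 - c * c) by lra; ring.
Qed.

Lemma rot_dot_axis th y : dot (rot n th y) n = dot y n.
Proof. rewrite <- (rot_axis th) at 2; apply rot_dot. Qed.

Lemma rot_add a b y : rot n (a + b) y = rot n a (rot n b y).
Proof.
(* For general [n] the composition law fails by a term with the factor [dot n n - 1]. *)
transitivity (vadd (rot n a (rot n b y)) (vscal (dot n n - 1)
  (vsub (vscal (sin a * sin b) y) (vscal ((1 - cos a) * (1 - cos b) * dot n y) n)))).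
- unfold rot; rewrite cos_plus, sin_plus.
  generalize (cos a) (sin a) (cos b) (sin b); clear; intros; vring.
- rewrite hn; generalize (rot n a (rot n b y)) (sin a * sin b); clear; intros; vring.
Qed.

Lemma rot_det th : det3 (rot n th e1) (rot n th e2) (rot n th e3) = 1.
Proof.
pose proof (sin2_cos2 th) as hcs; unfold Rsqr in hcs.
unfold rot; revert hcs; generalize (cos th) (sin th); intros c s hcs.
(* The determinant for general [n]: the factor along [n] times the determinant on the orthogonal
   plane. *)
transitivity ((c + (1 - c) * dot n n) * (c * c + s * s * dot n n)).
- unfold det3, e1, e2, e3; clear; dring.
- rewrite hn, Rmult_1_r, Rmult_1_r; lra.
Qed.

Lemma rot_derive w y t :
  is_derive (fun t => rot n (w * t) y) t (rot n (w * t) (vscal w (cross n y))).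
Proof.
set (c := fun t : R => cos (w * t)); set (s := fun t : R => sin (w * t)).
assert (hc : is_derive c t (- w * s t)) by (unfold c, s; auto_derive; [easy | ring]).
assert (hs : is_derive s t (w * c t)) by (unfold c, s; auto_derive; [easy | ring]).
assert (h1 : is_derive (fun t => (1 - c t) * dot n y) t (w * s t * dot n y)).
{ unfold c, s; auto_derive; [easy | ring]. }
assert (hconst : forall (k : R -> R) k' (u : vec), is_derive k t k' ->
  is_derive (fun r => vscal (k r) u) t (vscal k' u)).
{ intros k k' u hk; exact (is_derive_scal_l (V := vec) k t k' u hk). }
eapply is_derive_eq.
- apply (is_derive_plus (V := vec)); [apply (is_derive_plus (V := vec)) |];
    apply hconst; eassumption.
- unfold rot; fold (c t) (s t); rewrite cross_vscal_r, cross_cross_l, hn, !dot_vscal_r,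
    (dot_comm n (cross n y)), dot_cross_l.
  generalize (c t) (s t) (dot n y); clear; intros; vring.
Qed.

(** The velocity at time [t] is the initial one turned by the rotation, so inner products of
    velocities and directions keep their initial values. *)
Lemma screw_derive q w h x t :
  is_derive (fun t => screw n q w h t x) t (rot n (w * t) (screw_field n q w h x)).
Proof.
eapply is_derive_eq.
- apply (is_derive_plus (V := vec)); [| apply rot_derive].
  apply (is_derive_plus (V := vec) (fun _ => q) (fun t => vscal (t * h) n) t vzero (vscal h n)).
  + apply (is_derive_const (V := vec)).
  + apply (is_derive_scal_l (V := vec) (fun t => t * h) t h n); auto_derive; [easy | ring].
- unfold screw_field; rewrite rot_vadd, (rot_vscal n _ h), rot_axis.
  generalize (rot n (w * t) (vscal w (cross n (vsub x q)))); clear; intros; vring.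
Qed.

Lemma screw_add q w h s t x : screw n q w h (s + t) x = screw n q w h s (screw n q w h t x).
Proof.
unfold screw; rewrite Rmult_plus_distr_l, rot_add.
replace (vsub (vadd (vadd q (vscal (t * h) n)) (rot n (w * t) (vsub x q))) q)
  with (vadd (vscal (t * h) n) (rot n (w * t) (vsub x q))) by (clear; vring).
rewrite rot_vadd, rot_vscal, rot_axis.
generalize (rot n (w * s) (rot n (w * t) (vsub x q))); clear; intros; vring.
Qed.

Lemma screw_vsub q w h t x y :
  vsub (screw n q w h t x) (screw n q w h t y) = rot n (w * t) (vsub x y).
Proof.
unfold screw; rewrite !rot_vsub.
generalize (rot n (w * t) x) (rot n (w * t) y) (rot n (w * t) q); clear; intros; vring.
Qed.

End Rotation.

(** * Smoothness and admissibility of screw motions *)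

Ltac smooth_tac := repeat first
  [ apply smooth_vec | apply smooth_plus | apply smooth_minus | apply smooth_mult
  | apply smooth_cos | apply smooth_sin | apply smooth_id | apply smooth_const ].

Lemma smooth_rot (n : vec) (w : R) (y : vec) : smooth (fun t => rot n (w * t) y).
Proof.
apply smooth_vec; unfold rot; vec_simpl; unfold Rminus; smooth_tac.
all: try apply smooth_opp; smooth_tac.
Qed.

Lemma smooth_linear {U V : NormedModule R_AbsRing} (phi : U -> V) (f : R -> U) :
  is_linear phi -> smooth f -> smooth (fun t => phi (f t)).
Proof.
intros hphi hf n; specialize (hf n); revert f hf.
induction n as [|n IH]; intros f; simpl.
- intros hf t; apply (continuous_comp f phi); [apply hf | now apply linear_cont].
- intros [f' [hf cf]]; exists (fun t => phi (f' t)); split; [| now apply IH].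
  intros t; now apply is_derive_linear.
Qed.

Lemma smooth_components (f : R -> vec) :
  smooth f -> smooth (fun t => cx (f t)) /\ smooth (fun t => cy (f t)) /\ smooth (fun t => cz (f t)).
Proof.
intros hf.
pose proof (smooth_linear (U := vec) (V := prod_NormedModule _ R_NormedModule R_NormedModule)
  (fun p => fst p) f is_linear_fst hf) as h1.
split; [| split].
- exact (smooth_linear (U := prod_NormedModule _ R_NormedModule R_NormedModule)
    (fun p => fst p) _ is_linear_fst h1).
- exact (smooth_linear (U := prod_NormedModule _ R_NormedModule R_NormedModule)
    (fun p => snd p) _ is_linear_snd h1).
- exact (smooth_linear (U := vec) (fun p => snd p) f is_linear_snd hf).
Qed.

Lemma smooth_normal_part (v q : R -> vec) :
  smooth v -> smooth q -> smooth (fun t => normal_part (v t) (q t)).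
Proof.
intros hv hq; apply smooth_components in hv; apply smooth_components in hq.
destruct hv as [a [b c]], hq as [a' [b' c']].
assert (hd : smooth (fun t => dot (q t) (v t))).
{ unfold dot; apply smooth_plus; [apply smooth_plus |]; now apply smooth_mult. }
apply smooth_vec;
  [apply (smooth_minus (fun t => cx (q t)) (fun t => dot (q t) (v t) * cx (v t)))
  |apply (smooth_minus (fun t => cy (q t)) (fun t => dot (q t) (v t) * cy (v t)))
  |apply (smooth_minus (fun t => cz (q t)) (fun t => dot (q t) (v t) * cz (v t)))];
  try assumption; now apply smooth_mult.
Qed.

Lemma smooth_screw (n q : vec) (w h : R) (x : vec) : smooth (fun t => screw n q w h t x).
Proof.
destruct (smooth_components _ (smooth_rot n w (vsub x q))) as [a [b c]].
apply smooth_vec;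
  [apply (smooth_plus (fun t => cx q + t * h * cx n))
  |apply (smooth_plus (fun t => cy q + t * h * cy n))
  |apply (smooth_plus (fun t => cz q + t * h * cz n))]; try assumption; smooth_tac.
Qed.

Lemma screw_0 (n q : vec) (w h : R) (x : vec) : screw n q w h 0 x = x.
Proof.
unfold screw; rewrite Rmult_0_r, rot_trivial; [clear; vring | apply cos_0 | apply sin_0].
Qed.

Lemma screw_one_parameter_group (n q : vec) (w h : R) :
  dot n n = 1 -> one_parameter_group (screw n q w h).
Proof.
intros hn; split; [| split; [| split]].
- intros t; split.
  + intros x y; unfold enorm; now rewrite screw_vsub, rot_dot.
  + unfold orientation_preserving; rewrite !screw_vsub.
    replace (vsub e1 vzero) with e1 by (clear; unfold vzero; vring).
    replace (vsub e2 vzero) with e2 by (clear; unfold vzero; vring).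
    replace (vsub e3 vzero) with e3 by (clear; unfold vzero; vring).
    rewrite rot_det by exact hn; lra.
- intros x; apply screw_0.
- intros s t x; now apply screw_add.
- intros x; apply smooth_screw.
Qed.

(** Admissibility at [t = 0] is enough, because the rotation preserves every inner product involved.
    The velocity [U] of the moving point may replace that of the foot: they differ by multiples of
    [v] and [v'], both orthogonal to [v x v']. *)
Lemma screw_Hfam (alpha : R) (n q : vec) (w h : R) (l : oline) :
  alpha <> 0 -> dot n n = 1 ->
  let v' := vscal w (cross n (dir l)) in
  dot v' v' = alpha * alpha ->
  dot (screw_field n q w h (foot l)) (cross (dir l) v') = alpha ->
  exists f, Hfam alpha f /\ forall t, represents (fun s => screw n q w h t (point l s)) (f t).
Proof.
intros ha hn v' hv' hU.
assert (hv : dot (dir l) (dir l) = 1) by (apply enorm_1, dir_unit).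
set (U := screw_field n q w h (foot l)) in *.
assert (hunit : forall t, enorm (rot n (w * t) (dir l)) = 1).
{ intros t; apply enorm_1; rewrite rot_dot; assumption. }
set (f := fun t => line (screw n q w h t (foot l)) (rot n (w * t) (dir l)) (hunit t)).
assert (hf : forall t, represents (fun s => screw n q w h t (point l s)) (f t)).
{ intros t; refine (proj2 (represents_line _ _ _ (hunit t) (f t) _) eq_refl).
  intros s; unfold screw, point.
  replace (vsub (vadd (foot l) (vscal s (dir l))) q)
    with (vadd (vsub (foot l) q) (vscal s (dir l))) by (clear; vring).
  rewrite rot_vadd, rot_vscal.
  generalize (rot n (w * t) (vsub (foot l) q)) (rot n (w * t) (dir l)); clear; intros; vring. }
exists f; split; [| exact hf]; split.
{ exists (screw n q w h), l; split; [now apply screw_one_parameter_group | exact hf]. }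
split.
- apply (smooth_pair (U := vec) (V := vec)).
  + apply smooth_rot.
  + apply smooth_normal_part; [apply smooth_rot | apply smooth_screw].
- intros t.
  assert (hd1 : is_derive (fun r => dir (f r)) t (rot n (w * t) v')) by (now apply rot_derive).
  pose proof (screw_derive n hn q w h (foot l) t) as hd2.
  pose proof (is_derive_normal_part _ _ t _ _ hd1 hd2) as hd3.
  fold U in hd2, hd3.
  set (vt := rot n (w * t) (dir l)).
  set (ut := screw n q w h t (foot l)) in *.
  change (dir (f t)) with vt in hd3.
  eexists (_, _); split.
  + apply has_velocity_pair; split; [exact hd1 | exact hd3].
  + apply admissible_vector_intro; [exact ha | | | |]; simpl; fold vt ut.
    * unfold vt; rewrite rot_dot by exact hn; unfold v'.
      rewrite dot_vscal_r, dot_comm, dot_cross_r; ring.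
    * assert (h0 : dot (rot n (w * t) v') vt = 0).
      { unfold vt; rewrite rot_dot by exact hn; unfold v'; rewrite dot_vscal_l, dot_cross_r; ring. }
      assert (h1 : dot vt vt = 1) by (unfold vt; now rewrite rot_dot).
      unfold normal_part; dots; rewrite (dot_comm vt (rot n (w * t) v')), h0, h1; ring.
    * now rewrite rot_dot.
    * assert (hvt : rot n (w * t) v' = vscal w (cross n vt)).
      { unfold v', vt; rewrite rot_vscal, rot_cross_axis; reflexivity. }
      assert (h1 : dot vt vt = 1) by (unfold vt; now rewrite rot_dot).
      rewrite hvt.
      (* The terms along [v] and [v'] drop out, and the triple product is written with inner
         products only, to which [rot_dot] and [rot_dot_axis] apply. *)
      replace (dot _ (cross vt (vscal w (cross n vt)))) with
        (w * (dot (rot n (w * t) U) n * dot vt vt - dot vt n * dot (rot n (w * t) U) vt))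
        by (generalize (rot n (w * t) U); clear; intros; dring).
      unfold vt; rewrite !rot_dot_axis, !rot_dot by exact hn.
      rewrite <- hU; unfold v'; clear; dring.
Qed.

(** * Joining lines *)

(** Balls of [oline] are by definition balls of [ambient] pulled back along [emb]. *)
Lemma oline_continuous (f : R -> oline) (t : R) : smooth_curve f -> continuous f t.
Proof.
intros hf; apply (filterlim_locally f (f t)); intros eps.
exact (proj1 (filterlim_locally _ (emb (f t))) (smooth_continuous _ t hf) eps).
Qed.

Lemma joined_by_two {N : UniformSpace} (F : (R -> N) -> Prop) (f g : R -> N) (a b : R) :
  F f -> F g -> 0 < a -> 0 < b -> (forall t, continuous f t) -> (forall t, continuous g t) ->
  f a = g 0 -> joined_by F 2 (f 0) (g b).
Proof.
intros hF hG ha hb cf cg hfg.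
set (c := fun t => if Rle_dec t a then f t else g (t - a)).
assert (c1 : forall t, t <= a -> c t = f t) by (intros t ht; unfold c; now destruct Rle_dec).
assert (c2 : forall t, a <= t -> c t = g (t - a)).
{ intros t ht; unfold c; destruct Rle_dec as [h | h]; [| easy].
  replace t with a by lra; rewrite Rminus_diag; exact hfg. }
assert (cg' : forall t, continuous (fun r => g (r - a)) t).
{ intros t; apply (continuous_comp (fun r => r - a) g); [| apply cg].
  apply (continuous_minus (V := R_NormedModule)); [apply continuous_id | apply continuous_const]. }
(* Breakpoints [0], [a] and [a + b]; beyond index 2 the value is a filler. *)
exists 2%nat, c, (fun i => match i with O => 0 | 1%nat => a | _ => a + b end).
split; [lia | split; [apply c1; lra | split; [rewrite c2 by lra; f_equal; ring | split]]].
- apply continuous_on_forall; intros t _.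
  destruct (Rtotal_order t a) as [h | [h | h]].
  + apply (continuous_ext_loc _ f); [| apply cf].
    exists (mkposreal (a - t) (proj2 (Rlt_0_minus _ _) h)); intros r hr.
    symmetry; apply c1; apply Rabs_def2 in hr; simpl in hr; unfold minus, plus, opp in hr; simpl in hr; lra.
  (* At the junction, [c r] is either [f r] or [g (r - a)], and both lie in [P] for [r] near [a]. *)
  + intros P hP.
    assert (hPf : locally (f t) P) by (rewrite <- c1 by lra; exact hP).
    assert (hPg : locally (g (t - a)) P) by (rewrite <- c2 by lra; exact hP).
    apply (filter_imp (F := locally t) (fun r => P (f r) /\ P (g (r - a)))).
    * intros r [h1 h2]; unfold c; now destruct Rle_dec.
    * apply filter_and; [exact (cf t P hPf) | exact (cg' t P hPg)].
  + apply (continuous_ext_loc _ (fun r => g (r - a))); [| apply cg'].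
    exists (mkposreal (t - a) (proj2 (Rlt_0_minus _ _) h)); intros r hr.
    symmetry; apply c2; apply Rabs_def2 in hr; simpl in hr; unfold minus, plus, opp in hr; simpl in hr; lra.
- intros [| [| i]] hi; [| | lia]; (split; [lra |]).
  + exists f, 0; split; [exact hF |]; intros t ht; rewrite Rplus_0_r; apply c1; lra.
  + exists g, (- a); split; [exact hG |]; intros t ht; apply c2; lra.
Qed.

(** A helicoid around the common normal turns the direction of [l] into [v]. *)
Lemma Hfam_to_direction (alpha : R) (l : oline) (v : vec) :
  alpha <> 0 -> enorm v = 1 ->
  exists f t, Hfam alpha f /\ 0 < t /\ f 0 = l /\ dir (f t) = v.
Proof.
intros ha hv; apply enorm_1 in hv.
assert (hl : dot (dir l) (dir l) = 1) by (apply enorm_1, dir_unit).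
(* [c] is the cosine of the angle from [dir l] to [v], and the norm of [d] is its sine. *)
set (c := dot v (dir l)); set (d := vsub v (vscal c (dir l))).
assert (hd : dot d (dir l) = 0) by (unfold d; dots; rewrite hl; fold c; ring).
assert (hdd : dot d d = 1 - c * c).
{ unfold d; dots; rewrite hl, hv, (dot_comm (dir l) v); fold c; ring. }
destruct (polar d (dir l) hd) as [b [hb [hbl hdb]]].
assert (hc : -1 <= c <= 1) by (pose proof (enorm_sqr d); nra).
assert (hs : sin (acos c) = enorm d).
{ rewrite sin_acos by exact hc; unfold enorm; rewrite hdd; unfold Rsqr; reflexivity. }
pose proof (acos_bound c) as hth; pose proof PI_RGT_0 as hpi.
set (A := cross (dir l) b).
assert (hA : dot A A = 1).
{ unfold A; rewrite dot_cross_cross, hl, hb, (dot_comm (dir l) b), hbl; ring. }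
assert (hAl : dot A (dir l) = 0) by apply dot_cross_l.
assert (hB : cross A (dir l) = b).
{ unfold A; rewrite cross_cross_r, hl, hbl; clear; vring. }
(* The helicoidal curve itself: angular speed [alpha] and unit speed along the axis [A] through the
   foot. *)
destruct (screw_Hfam alpha A (foot l) alpha 1 l ha hA) as [f [hf hrep]].
{ rewrite hB; dots; rewrite hb; ring. }
{ rewrite cross_vscal_r, hB; fold A; unfold screw_field.
  replace (vsub (foot l) (foot l)) with vzero by (clear; vring).
  dots; rewrite hA; unfold vzero; clear; dring. }
(* [alpha * t] must be [acos c] up to a full turn; the extra turn keeps [t] positive when
   [acos c = 0] or [alpha] is negative. *)
assert (ht : exists t, 0 < t /\ cos (alpha * t) = c /\ sin (alpha * t) = enorm d).
{ destruct (Rlt_or_le 0 alpha) as [h | h].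
  - exists ((acos c + 2 * PI) / alpha); split; [apply Rdiv_lt_0_compat; lra |].
    replace (alpha * _) with (acos c + 2 * INR 1 * PI) by (simpl; field; exact ha).
    rewrite cos_period, sin_period, cos_acos; easy.
  - exists ((2 * PI - acos c) / (- alpha)); split; [apply Rdiv_lt_0_compat; lra |].
    replace (alpha * _) with (acos c - 2 * INR 1 * PI) by (simpl; field; exact ha).
    rewrite <- (cos_period _ 1), <- (sin_period _ 1).
    replace (_ + 2 * INR 1 * PI) with (acos c) by ring.
    rewrite cos_acos; easy. }
destruct ht as [t [ht [hct hst]]].
exists f, t; split; [exact hf | split; [exact ht | split]].
- apply (represents_unique _ _ _ (hrep 0)); exists 0; intros s.
  rewrite screw_0; f_equal; ring.
- rewrite (represents_dir _ _ (hrep t)), screw_vsub.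
  replace (vsub (point l 1) (point l 0)) with (dir l) by (unfold point; clear; vring).
  unfold rot; rewrite hct, hst, hB, hAl.
  transitivity (vadd (vscal c (dir l)) d); [rewrite hdb at 2 | unfold d]; clear; vring.
Qed.

(** A full turn about an axis at angle [PI / 4] to the common direction. Since
    the axis is not orthogonal to the lines, admissibility can be achieved for
    every pitch, by moving the axis sideways by [kappa]. *)
Lemma Hfam_parallel (alpha : R) (l m : oline) :
  alpha <> 0 -> dir l = dir m ->
  exists f t, Hfam alpha f /\ 0 < t /\ f 0 = l /\ f t = m.
Proof.
intros ha hdir.
assert (hv : dot (dir l) (dir l) = 1) by (apply enorm_1, dir_unit).
set (d := vsub (foot m) (foot l)).
assert (hd : dot d (dir l) = 0).
{ unfold d; dots; rewrite foot_orth, hdir, foot_orth; ring. }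
destruct (polar d (dir l) hd) as [k [hk [hkl hdk]]].
set (delta := enorm d) in *.
set (v := dir l) in *.
set (r := / sqrt 2).
assert (h2 : 0 < sqrt 2) by (apply sqrt_lt_R0; lra).
assert (hr0 : r <> 0) by (apply Rinv_neq_0_compat; lra).
assert (hr : r * r = / 2).
{ unfold r; rewrite <- Rinv_mult, sqrt_sqrt by lra; reflexivity. }
(* The axis bisects [k] and [v], so [n x v] has norm [r]; this [w] gives [v'] the norm [|alpha|]. *)
set (w := 2 * alpha * r); set (n := vscal r (vadd k v)).
assert (hw : w <> 0) by (unfold w; apply Rmult_integral_contrapositive; split; [lra | exact hr0]).
pose proof (Rabs_pos_lt _ hw) as hwa.
set (T := 2 * PI / Rabs w).
assert (hT : 0 < T) by (apply Rdiv_lt_0_compat; [pose proof PI_RGT_0; lra | exact hwa]).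
(* A full turn then translates by [T h n = delta (k + v)]: the wanted [d = delta k], plus a slide of
   the line along itself. If [d] is zero, so is [h]. *)
set (h := 2 * r * delta / T).
(* The solution of the admissibility equation, which reduces to [alpha * r * h - alpha * alpha *
   kappa = alpha]. *)
set (kappa := (r * h - 1) / alpha).
set (q := vsub (foot l) (vscal kappa (cross v k))).
assert (hn : dot n n = 1).
{ unfold n; dots; rewrite hk, hv, hkl, (dot_comm v k), hkl; lra. }
assert (hnv : dot n v = r) by (unfold n; dots; rewrite hkl, hv; ring).
assert (hcs : cos (w * T) = 1 /\ sin (w * T) = 0).
{ unfold T, Rabs; destruct Rcase_abs.
  - replace (w * (2 * PI / - w)) with (- (2 * PI)) by (field; exact hw).
    rewrite cos_neg, sin_neg, cos_2PI, sin_2PI; lra.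
  - replace (w * (2 * PI / w)) with (2 * PI) by (field; exact hw).
    rewrite cos_2PI, sin_2PI; lra. }
destruct (screw_Hfam alpha n q w h l ha hn) as [f [hf hrep]]; fold v.
{ dots; rewrite dot_cross_cross, hn, hv, (dot_comm v n), hnv; unfold w.
  transitivity (4 * (alpha * alpha) * (r * r) * (1 - r * r)); [ring | rewrite hr; field]. }
{ rewrite cross_vscal_r, cross_cross_l, hv, (dot_comm v n), hnv.
  unfold screw_field.
  replace (vsub (foot l) q) with (vscal kappa (cross v k)) by (unfold q; clear; vring).
  assert (hcr : dot (cross n (vscal kappa (cross v k))) v = kappa * r).
  { unfold n; transitivity (kappa * r * (dot v v * dot k k - dot v k * dot v k));
      [clear; dring | rewrite hv, hk, (dot_comm v k), hkl; ring]. }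
  dots; rewrite hn, hnv, hcr, dot_cross_l.
  transitivity (2 * alpha * r * (h - r * r * h) - 4 * alpha * alpha * kappa * (r * r) * (r * r));
    [unfold w; ring |].
  rewrite hr; unfold kappa; field; exact ha. }
exists f, T; split; [exact hf | split; [exact hT | split]].
- apply (represents_unique _ _ _ (hrep 0)); exists 0; intros s.
  rewrite screw_0; f_equal; ring.
(* The slide along the line appears as the parameter shift [delta]. *)
- apply (represents_unique _ _ _ (hrep T)); exists delta; intros s.
  unfold screw; rewrite rot_trivial by apply hcs.
  assert (hTh : vscal (T * h) n = vadd d (vscal delta v)).
  { rewrite hdk; transitivity (vscal (2 * (r * r) * delta) (vadd k v)).
    - unfold n; replace (T * h) with (2 * r * delta) by (unfold h; field; lra).
      clear; vring.
    - rewrite hr; replace (2 * / 2 * delta) with delta by field; clear; vring. }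
  rewrite hTh; unfold point; rewrite <- hdir; fold v; unfold d; clear; vring.
Qed.

(** * The Kendall number *)

Theorem proposition23 (alpha : R) (halpha : alpha <> 0) :
  is_kendall_number (Hfam alpha) 2.
Proof.
split.
- intros x y _.
  destruct (Hfam_to_direction alpha x (dir y) halpha (dir_unit y)) as [f [a [hf [ha [<- hfa]]]]].
  destruct (Hfam_parallel alpha (f a) y halpha hfa) as [g [b [hg [hb [hg0 <-]]]]].
  apply joined_by_two with (a := a); try assumption; [| | now symmetry];
    intros t; apply oline_continuous; [apply hf | apply hg].
- intros m hm; destruct (Nat.le_gt_cases 2 m) as [h | h]; [exact h | exfalso].
  (* The counterexample to one piece: the vertical axis through the origin with its two
     orientations. *)
  set (x := line vzero e3 enorm_e3).
  assert (hu : enorm (vscal (-1) e3) = 1).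
  { apply enorm_1; dots; rewrite (proj1 (enorm_1 _) enorm_e3); ring. }
  set (y := line vzero (vscal (-1) e3) hu).
  assert (hxy : x <> y).
  { intros e; apply (f_equal (fun l => cz (dir l))) in e; simpl in e.
    unfold e3, mkvec in e; vec_simpl; lra. }
  destruct (hm x y hxy) as [k [c [tau [hk [h0 [h1 [_ hp]]]]]]].
  (* No piece at all would give [x = y], and two or more exceed the bound [m], so there is exactly
     one. *)
  destruct k as [| [| k]]; [apply hxy; congruence | | lia].
  destruct (hp 0%nat (Nat.lt_0_succ 0)) as [ht [f [s [hf hc]]]].
  rewrite hc in h0, h1 by lra.
  apply halpha, (Hfam_no_reversal alpha f (tau 0%nat + s) (tau 1%nat + s) hf); [lra | |];
    rewrite h0, h1; [reflexivity |].
  simpl; unfold normal_part, vzero; clear; vring.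
Qed.
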